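(* Let $k\ge2$ be an integer. For a random non-plane recursive tree of size $n$, let $Z_n^{(k)}$ be its $k$-th order generalized Zagreb index, $R_n$ the degree of its root, and $\bar Z_n=Z_n^{(k)}-\mathbb{E}(Z_n^{(k)})$. Then for all integers $r,s\ge0$, $$\mathbb{E}(\bar Z_n^rR_n^s)=\hat{\mathcal O}(n^{r/2}).$$ Moreover, there is a constant $\sigma_k$ such that for every $r\ge 0$ $$\mathbb{E}(\bar Z_n^r)\sim g_r\,\sigma_k^r\,n^{r/2},\qquad n\to\infty,$$ where $$g_r=\begin{cases}\dfrac{(2m)!}{2^m m!},&\text{if } r=2m;\\[4pt] 0,&\text{if } r=2m+1.\end{cases}$$ (Here the relation $\sim$ means $\mathbb{E}(\bar Z_n^r)/n^{r/2}\to g_r\sigma_k^r$; in particular the limit is $0$ for odd $r$.)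
   Context: A random non-plane recursive tree of size $n$ is built as follows: start with a root labeled $1$; in step $i$ ($2\le i\le n$) the node labeled $i$ becomes a child of one of the $i-1$ existing nodes, chosen uniformly at random. The children of a node are not ordered. For a graph $G=(V,E)$, the $k$-th order generalized Zagreb index is $\sum_{v\in V}D_v^k$, where $D_v$ is the (graph) degree of $v$. The notation $a_n=\hat{\mathcal O}(n^{\alpha})$ is the $\mathcal O$-notation with logarithmic terms suppressed: there is an integer $K\ge0$ with $a_n=\mathcal O(n^{\alpha}\log^K n)$ as $n\to\infty$. *)

(* Defs.v *)
From HB Require Import structures.
From mathcomp Require Import all_boot all_order all_algebra.
From mathcomp Require Import all_classical all_reals all_analysis.

Set Implicit Arguments.
Unset Strict Implicit.
Unset Printing Implicit Defensive.

Import Order.TTheory GRing.Theory Num.Theory.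
Import numFieldNormedType.Exports.

Local Open Scope classical_set_scope.
Local Open Scope ring_scope.

(** Simple graphs, given by their adjacency relation. *)

Definition degree (V : finType) (e : rel V) (v : V) : nat :=
  #|[set w : V | e v w]%SET|.

Definition zagreb (k : nat) (V : finType) (e : rel V) : nat :=
  (\sum_(v : V) degree e v ^ k)%N.

(** Recursive trees.  The node labelled [i] is the natural number [i.-1], so
    the root is [0], and the node [m.+1] picks its parent in ['I_m.+1], the set
    of nodes already present.  [growth m] is the type of recursive trees with
    [m.+1] nodes, each given by the successive choices of parents. *)

Fixpoint growth (m : nat) : finType :=
  if m is m'.+1 then (growth m' * 'I_m'.+1)%type else unit.

Fixpoint child_of (m : nat) : growth m -> rel nat :=
  match m return growth m -> rel nat with
  | 0 => fun _ _ _ => false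
  | m'.+1 => fun t u v =>
      ((u == t.2 :> nat) && (v == m'.+1)) || child_of t.1 u v
  end.

Definition tree_edge (m : nat) (t : growth m) : rel 'I_m.+1 :=
  fun u v => child_of t u v || child_of t v u.

(** Each new node picks its parent uniformly, given the tree built so far. *)
Fixpoint growth_prob (R : realType) (m : nat) : growth m -> R :=
  match m return growth m -> R with
  | 0 => fun _ => 1
  | m'.+1 => fun t => growth_prob R t.1 * (m'.+1)%:R^-1
  end.

(** Only sizes [n >= 1] are meaningful ([rec_tree 0] is [rec_tree 1]); all the
    uses below are asymptotic in [n]. *)
Definition rec_tree (n : nat) : finType := growth n.-1.

Definition expect (R : realType) (n : nat) (X : rec_tree n -> R) : R :=
  \sum_(t : rec_tree n) growth_prob R t * X t.

Definition Zagreb_index (R : realType) (k n : nat) (t : rec_tree n) : R :=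
  (zagreb k (tree_edge t))%:R.

Definition root_degree (R : realType) (n : nat) (t : rec_tree n) : R :=
  (degree (tree_edge t) ord0)%:R.

Definition Zagreb_bar (R : realType) (k n : nat) (t : rec_tree n) : R :=
  Zagreb_index R k t - expect (@Zagreb_index R k n).

Definition Ohat (R : realType) (a : nat -> R) (alpha : R) : Prop :=
  exists K : nat,
    (a : nat -> R^o) =O_\oo (fun n => n%:R `^ alpha * ln n%:R ^+ K : R^o).

Definition gauss_moment (R : realType) (r : nat) : R :=
  if odd r then 0 else r`!%:R / (2 ^+ r./2 * (r./2)`!%:R).

(* Main.v *)
Require Import Defs.
From HB Require Import structures.
From mathcomp Require Import all_boot all_order all_algebra.
From mathcomp Require Import all_classical all_reals all_analysis.
From mathcomp Require Import ring lra zify.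
From Stdlib Require Import Permutation.

Set Implicit Arguments.
Unset Strict Implicit.
Unset Printing Implicit Defensive.

Import Order.TTheory GRing.Theory Num.Theory.
Import numFieldNormedType.Exports.

Local Open Scope classical_set_scope.
Local Open Scope ring_scope.

(** Let [d_v] be the degree of [v].  For a polynomial [f] put
    [S_f = \sum_v f(d_v)], so that the Zagreb index is the case [f = 'X^k].
    When a new node is attached to [v], [S_f] grows by [(Delta f)(d_v) + f(1)]
    with [Delta f = f(X + 1) - f].  There is a linear functional [nu] (the mean
    under the limiting degree law) with [nu f = f(1) + nu (Delta f)], and with
    [n] the number of nodes, the centred sum [X_f = S_f - n * nu f] simply grows
    by [(D f)(d_v)], where [D f = Delta f - nu (Delta f)].  As [v] is uniform,
    averaging over [v] turns any [q(d_v)] into [nu q + X_q / n]: products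
    [X_(f_1) ... X_(f_r)] are mapped to combinations of such products, so their
    means (the moments of words [f_1 ... f_r]) satisfy a closed recurrence in
    [n] ([momentS]).

    Expanding [\prod_i (X_(f_i) + (D f_i)(d_v))], the terms of order [n^(r/2-1)]
    come from one increment, [X_(D f_i) / n], and from two increments,
    [nu (D f_i * D f_j)]; all others are smaller by a factor [n^(-1/2)] at
    least.  The operator [D] lowers degrees, so induction on the length of the
    word and then on its total degree, together with the Stolz-Cesaro theorem,
    shows that the moment of a word of length [r], divided by [n^(r/2)],
    converges ([cvg_normalized_moment]).  The limit [L] must satisfy
    [(r/2) L(w) = \sum_i L(w with D f_i for f_i)
       + \sum_(i<j) nu (D f_i * D f_j) L(w without f_i, f_j)],
    and this is what Wick's formula gives when the covariance solves the
    Lyapunov equation [cov f g = cov (D f) g + cov f (D g) + nu (D f * D g)]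
    ([wick_lyapunov]).  On the constant word [f ... f] Wick's formula gives the
    Gaussian moments with variance [cov f f].  Centring at the true mean instead
    of [n * nu f] changes nothing, since the mean of [X_f] is [o(sqrt n)].

    For the mixed moments, Young's inequality separates the even moments of the
    Zagreb index, just estimated, from those of the root degree, which are
    polylogarithmic because the root gains a child with probability [1/n]
    ([root_moment_le]). *)

(** * Degrees and averages under uniform attachment *)

Lemma child_of_lt m (t : growth m) u v : child_of t u v -> (u < v <= m)%N.
Proof.
elim: m t u v => [|m IH] //= [t p] u v /= /orP[/andP[/eqP-> /eqP->]|/IH].
  by rewrite leqnn andbT ltn_ord.
by move=> /andP[-> /leqW].
Qed.

Lemma degreeE m (t : growth m) (u : 'I_m.+1) :
  degree (tree_edge t) u = (\sum_(w < m.+1) tree_edge t u w)%N.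
Proof. by rewrite /degree cardsE -sum1_card big_mkcond; apply: eq_bigr. Qed.

Lemma degree_widen m (t : growth m) (v u : 'I_m.+1) :
  degree (@tree_edge m.+1 (t, v)) (widen_ord (leqnSn _) u) =
  (degree (tree_edge t) u + (u == v))%N.
Proof.
rewrite !degreeE big_ord_recr /=; congr (_ + _)%N.
  apply: eq_bigr => w _; rewrite /tree_edge /=.
  by rewrite !(ltn_eqF (ltn_ord _)) !andbF.
have uv : (u == v :> nat) = (u == v) by [].
rewrite /tree_edge /= eqxx andbT (ltn_eqF (ltn_ord u)) andbF /= uv.
have H1 : child_of t u m.+1 = false.
  by apply/negP => /child_of_lt; rewrite ltnn andbF.
have H2 : child_of t m.+1 u = false.
  by apply/negP => /child_of_lt/andP[]; rewrite ltnNge ltnW.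
by rewrite H1 H2 !orbF.
Qed.

Lemma degree_new m (t : growth m) (v : 'I_m.+1) :
  degree (@tree_edge m.+1 (t, v)) ord_max = 1%N.
Proof.
have H1 u : child_of t u m.+1 = false.
  by apply/negP => /child_of_lt; rewrite ltnn andbF.
have H2 (w : 'I_m.+1) : child_of t m.+1 w = false.
  by apply/negP => /child_of_lt/andP[]; rewrite ltnNge ltnW.
rewrite degreeE big_ord_recr /= [X in (_ + X)%N](_ : _ = 0%N); last first.
  by rewrite /tree_edge /= H1 (gtn_eqF (ltn_ord v)).
rewrite addn0 (bigD1 v) //= big1 ?addn0.
  by rewrite /tree_edge /= !eqxx orbT.
move=> w wv; rewrite /tree_edge /= H1 H2 (gtn_eqF (ltn_ord v)) eqxx andbT /= orbF.
by rewrite (_ : (w == v :> nat) = (w == v)) // (negbTE wv).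
Qed.

Section Mean.
Variable R : realType.

Definition tree_mean (m : nat) (X : growth m -> R) : R :=
  \sum_(t : growth m) growth_prob R t * X t.

Lemma tree_meanS m (X : growth m.+1 -> R) :
  tree_mean X =
  tree_mean (fun t : growth m => m.+1%:R^-1 * \sum_(v < m.+1) X (t, v)).
Proof.
transitivity (\sum_(p : growth m * 'I_m.+1)
  growth_prob R p.1 * m.+1%:R^-1 * X (p.1, p.2)).
  by apply: eq_bigr => -[t v] _.
rewrite -(pair_bigA _ (fun (t : growth m) (v : 'I_m.+1) =>
  growth_prob R t * m.+1%:R^-1 * X (t, v))) /=.
apply: eq_bigr => t _; rewrite !mulr_sumr.
by apply: eq_bigr => v _; rewrite mulrA.
Qed.

Lemma growth_prob_ge0 m (t : growth m) : 0 <= growth_prob R t.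
Proof. by elim: m t => [|m IH] //= [t v]; rewrite mulr_ge0. Qed.

Lemma eq_tree_mean m (X Y : growth m -> R) :
  X =1 Y -> tree_mean X = tree_mean Y.
Proof. by move=> XY; apply: eq_bigr => t _; rewrite XY. Qed.

Lemma tree_meanD m (X Y : growth m -> R) :
  tree_mean (fun t => X t + Y t) = tree_mean X + tree_mean Y.
Proof. by rewrite /tree_mean -big_split; apply: eq_bigr => t _; rewrite mulrDr. Qed.

Lemma tree_meanZ m c (X : growth m -> R) :
  tree_mean (fun t => c * X t) = c * tree_mean X.
Proof. by rewrite /tree_mean mulr_sumr; apply: eq_bigr => t _; rewrite mulrCA. Qed.

Lemma tree_mean_sum m (I : Type) (s : seq I) (X : I -> growth m -> R) :
  tree_mean (fun t => \sum_(i <- s) X i t) = \sum_(i <- s) tree_mean (X i).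
Proof.
by rewrite /tree_mean exchange_big /=; apply: eq_bigr => t _; rewrite mulr_sumr.
Qed.

Lemma tree_mean_cst m c : tree_mean (fun _ : growth m => c) = c.
Proof.
elim: m => [|m IH]; first by rewrite /tree_mean (bigD1 (tt : growth 0)) //= big1 ?mul1r ?addr0 // => -[].
rewrite tree_meanS -[RHS]IH; apply: eq_tree_mean => t.
by rewrite sumr_const card_ord -[c *+ _]mulr_natl mulKf ?pnatr_eq0.
Qed.

Lemma ler_tree_mean m (X Y : growth m -> R) :
  (forall t, X t <= Y t) -> tree_mean X <= tree_mean Y.
Proof.
by move=> XY; apply: ler_sum => t _; apply: ler_wpM2l (XY t); exact: growth_prob_ge0.
Qed.

(** Young's inequality with weight [c], averaged over the trees; the freedom in
    [c] lets the two second moments be of different orders of magnitude. *)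
Lemma normr_tree_mean_mul_le m (c : R) (X Y : growth m -> R) : 0 < c ->
  `|tree_mean (fun t => X t * Y t)| <=
  2^-1 * (c^-1 * tree_mean (fun t => X t ^+ 2) + c * tree_mean (fun t => Y t ^+ 2)).
Proof.
move=> c0; have young e : e ^+ 2 = 1 -> e * tree_mean (fun t => X t * Y t) <=
    2^-1 * (c^-1 * tree_mean (fun t => X t ^+ 2) + c * tree_mean (fun t => Y t ^+ 2)).
  move=> ee; rewrite -!tree_meanZ -tree_meanD -tree_meanZ.
  apply: ler_tree_mean => t.
  have : 0 <= c^-1 * (X t - e * c * Y t) ^+ 2.
    by rewrite mulr_ge0 ?sqr_ge0 // invr_ge0 ltW.
  rewrite sqrrB !exprMn ee mul1r.
  have -> : c^-1 * (X t ^+ 2 - X t * (e * c * Y t) *+ 2 + c ^+ 2 * Y t ^+ 2) =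
      c^-1 * X t ^+ 2 + c * Y t ^+ 2 - 2 * (e * (X t * Y t)).
    by field; rewrite gt_eqF.
  lra.
rewrite ler_norml; apply/andP; split.
  by rewrite lerNl -mulN1r young // sqrrN expr1n.
by rewrite -[leLHS]mul1r young // expr1n.
Qed.

End Mean.

(** * The difference operator, the limiting mean and the limiting covariance *)

Section Poly.
Variable R : realType.
Implicit Types (f g p q : {poly R}).

Definition fdiff p : {poly R} := p \Po ('X + 1) - p.

Lemma fdiffC c : fdiff c%:P = 0.
Proof. by rewrite /fdiff comp_polyC subrr. Qed.

Lemma fdiffB p q : fdiff (p - q) = fdiff p - fdiff q.
Proof. by rewrite /fdiff comp_polyB; ring. Qed.

Lemma size_fdiff p : (size (fdiff p) <= (size p).-1)%N.
Proof.
elim/poly_ind: p => [|p c IH]; first by rewrite fdiffC size_poly0.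
have -> : fdiff (p * 'X + c%:P) = fdiff p * ('X + 1) + p.
  rewrite /fdiff comp_polyD comp_polyM comp_polyX comp_polyC; ring.
have [->|p0] := eqVneq p 0.
  by rewrite fdiffC mul0r addr0 size_poly0.
rewrite size_MXaddC (negbTE p0) /=.
apply: leq_trans (size_polyD _ _) _; rewrite geq_max leqnn andbT.
have s2 : size ('X + 1 : {poly R}) = 2 by rewrite -[1]/(1%:P) size_XaddC.
apply: leq_trans (size_polyMleq _ _) _; rewrite s2 addn2 /=.
by rewrite -(prednK (n := size p)) ?ltnS // size_poly_gt0.
Qed.

Lemma size_iter_fdiff j p : (size (iter j fdiff p) <= size p - j)%N.
Proof.
elim: j => [|j IH]; first by rewrite subn0.
by rewrite iterS (leq_trans (size_fdiff _)) // subnS -!subn1 leq_sub2r.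
Qed.

(** The mean of [p] under the limiting degree law, which gives [d >= 1] the mass
    [2^-d]: solving [nu p = p(1) + nu (fdiff p)] by iteration gives this sum,
    finite because [fdiff] lowers degrees. *)
Definition nu p : R := \sum_(j < size p) (iter j fdiff p).[1].

Lemma nu_widen n p : (size p <= n)%N -> nu p = \sum_(j < n) (iter j fdiff p).[1].
Proof.
move=> pn; rewrite /nu (big_ord_widen n (fun j => (iter j fdiff p).[1]) pn).
rewrite big_mkcond /=; apply: eq_bigr => j _; case: ltnP => // pj.
suff -> : iter j fdiff p = 0 by rewrite horner0.
apply/eqP; rewrite -size_poly_eq0 -leqn0.
by rewrite (leq_trans (size_iter_fdiff _ _)) // leqn0 subn_eq0.
Qed.

(** The balance equation of the degree law: a new node has degree 1, and an old
    one gains an edge at rate [1/n]. *)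
Lemma nu_fdiff p : nu p = p.[1] + nu (fdiff p).
Proof.
rewrite (nu_widen (leqnSn _)) big_ord_recl /=; congr (_ + _).
rewrite (nu_widen (leq_trans (size_fdiff p) (leq_pred _))).
by apply: eq_bigr => j _; rewrite -iterS iterSr.
Qed.

Lemma nuC c : nu c%:P = c.
Proof. by rewrite nu_fdiff fdiffC /nu size_poly0 big_ord0 addr0 hornerC. Qed.

Lemma nuB p q : nu (p - q) = nu p - nu q.
Proof.
set N := maxn (size (p - q)) (maxn (size p) (size q)).
have pN : (size p <= N)%N by rewrite /N; lia.
have qN : (size q <= N)%N by rewrite /N; lia.
have pqN : (size (p - q)%R <= N)%N by rewrite /N; lia.
rewrite (nu_widen pN) (nu_widen qN) (nu_widen pqN) -sumrB; apply: eq_bigr => j _.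
rewrite -hornerN -hornerD; congr (_.[_]).
by elim: (j : nat) => //= i ->; rewrite fdiffB.
Qed.

(** The increment of a centred sum.  As [nu (drift p) = 0], replacing one letter
    by its increment leaves a word of the same length, with a factor [1/n], and
    no shorter word. *)
Definition drift p : {poly R} := fdiff p - (nu (fdiff p))%:P.

Lemma nu_drift p : nu (drift p) = 0.
Proof. by rewrite nuB nuC subrr. Qed.

Lemma drift_small p : (size p <= 1)%N -> drift p = 0.
Proof. by move=> /size1_polyC->; rewrite /drift fdiffC -polyC0 nuC subrr. Qed.

Lemma size_drift p : (size (drift p) <= (size p).-1)%N.
Proof.
have [p1|p1] := leqP (size p) 1; first by rewrite drift_small // size_poly0.
rewrite (leq_trans (size_polyD _ _)) // geq_max size_fdiff size_polyN.
by rewrite (leq_trans (size_polyC_leq1 _)) // -ltnS prednK // ltnW.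
Qed.

(** The limiting mean of the product of the increments of two centred sums. *)
Definition increment_cov f g : R := nu (drift f * drift g).

(** The solution of the Lyapunov equation [covE], by recursion on a bound [n] for
    the sum of the sizes, which [drift] decreases. *)
Fixpoint cov_rec n f g : R :=
  if n is n'.+1 then cov_rec n' (drift f) g + cov_rec n' f (drift g) + increment_cov f g
  else 0.

Definition cov f g := cov_rec (size f + size g) f g.

Lemma increment_covC f g : increment_cov f g = increment_cov g f.
Proof. by rewrite /increment_cov mulrC. Qed.

Lemma cov_recC n f g : cov_rec n f g = cov_rec n g f.
Proof. by elim: n f g => //= n IH f g; rewrite increment_covC !(IH _ g) (IH _ (drift g)); ring. Qed.

Lemma covC f g : cov f g = cov g f.
Proof. by rewrite /cov cov_recC addnC. Qed.

Lemma cov_rec_small n f g : (size f <= 1)%N -> cov_rec n f g = 0.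
Proof.
elim: n f g => //= n IH f g f1; rewrite (IH f) // /increment_cov drift_small //.
by rewrite IH ?size_poly0 // mul0r -polyC0 nuC !addr0.
Qed.

(** The sum of a constant over the nodes is deterministic. *)
Lemma cov_small f g : (size f <= 1)%N -> cov f g = 0.
Proof. exact: cov_rec_small. Qed.

Lemma cov_rec_stable n f g : (size f + size g <= n)%N ->
  cov_rec n f g = cov f g.
Proof.
suff H m : (size f + size g <= m)%N -> cov_rec m.+1 f g = cov_rec m f g.
  move=> /subnK <-; elim: (n - _)%N => [//|j IH].
  by rewrite addSn H // leq_addl.
elim: m f g => [|m IH] f g fgm.
  by rewrite !cov_rec_small //; lia.
have [f1|f1] := leqP (size f) 1; first by rewrite !cov_rec_small.
have [g1|g1] := leqP (size g) 1; first by rewrite !(cov_recC _ f) !cov_rec_small.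
have := size_drift f; have := size_drift g => dg df.
rewrite [LHS]/= -/(cov_rec m.+1 (drift f) g) -/(cov_rec m.+1 f (drift g)).
by rewrite (IH (drift f)) ?(IH f (drift g)) //; lia.
Qed.

Lemma covE f g : cov f g = cov (drift f) g + cov f (drift g) + increment_cov f g.
Proof.
have := size_drift f; have := size_drift g => dg df.
rewrite -(@cov_rec_stable (size f + size g).+1 f g) //=.
by rewrite !cov_rec_stable ?leq_add2l ?leq_add2r // (leq_trans df, leq_trans dg) ?leq_pred.
Qed.

End Poly.

(** * Wick's formula over words *)

Section Picks.
Variables (T : Type) (R : realType).

(** One choice of a letter, with the rest of the word in its original order;
    keeping the order makes the result of two choices independent of which letter
    is taken first. *)
Fixpoint picks (w : seq T) : seq (T * seq T) :=
  if w is a :: w' then (a, w') :: [seq (p.1, a :: p.2) | p <- picks w'] else [::].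

Fixpoint pairs (w : seq T) : seq (T * T * seq T) :=
  if w is a :: w' then
    [seq (a, p.1, p.2) | p <- picks w'] ++
    [seq (p.1, a :: p.2) | p <- pairs w']
  else [::].

Lemma big_picks_cons a w (F : T -> seq T -> R) :
  \sum_(p <- picks (a :: w)) F p.1 p.2 =
  F a w + \sum_(p <- picks w) F p.1 (a :: p.2).
Proof. by rewrite big_cons big_map. Qed.

Lemma big_pairs_cons a w (F : T -> T -> seq T -> R) :
  \sum_(p <- pairs (a :: w)) F p.1.1 p.1.2 p.2 =
  \sum_(p <- picks w) F a p.1 p.2 +
  \sum_(p <- pairs w) F p.1.1 p.1.2 (a :: p.2).
Proof. by rewrite big_cat !big_map. Qed.

(** Two successive choices are an unordered pair of positions together with an
    order on it.  The symmetry of Wick's formula and [wick_lyapunov] both reduce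
    to this. *)
Lemma big_picks2 w (F : T -> T -> seq T -> R) :
  \sum_(p <- picks w) \sum_(q <- picks p.2) F p.1 q.1 q.2 =
  \sum_(p <- pairs w) (F p.1.1 p.1.2 p.2 + F p.1.2 p.1.1 p.2).
Proof.
elim: w F => [|a w IH] F; first by rewrite !big_nil.
rewrite (big_picks_cons a w (fun f u => \sum_(q <- picks u) F f q.1 q.2)).
rewrite (big_pairs_cons a w (fun f g v => F f g v + F g f v)).
under [X in _ + X = _]eq_bigr => p _.
  rewrite (big_picks_cons a p.2 (fun g v => F p.1 g v)); over.
by rewrite !big_split /= (IH (fun f g v => F f g (a :: v))) big_split /=; ring.
Qed.

Lemma big_picks2_swap w (F : T -> T -> seq T -> R) :
  \sum_(p <- picks w) \sum_(q <- picks p.2) F p.1 q.1 q.2 =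
  \sum_(p <- picks w) \sum_(q <- picks p.2) F q.1 p.1 q.2.
Proof.
rewrite big_picks2 (big_picks2 w (fun f g v => F g f v)).
by apply: eq_bigr => p _; rewrite addrC.
Qed.

Lemma Permutation_picks s t (F : T -> seq T -> R) :
  (forall a u v, Permutation u v -> F a u = F a v) -> Permutation s t ->
  \sum_(p <- picks s) F p.1 p.2 = \sum_(p <- picks t) F p.1 p.2.
Proof.
move=> HF st; elim: st F HF => {s t}
  [|a s t st IH|a b s|s t u st IH1 tu IH2] F HF //.
- rewrite !big_picks_cons (HF a _ _ st); congr (_ + _).
  by apply: (IH (fun b u => F b (a :: u))) => b u v uv; apply: HF; apply: Permutation.perm_skip.
- rewrite !(big_picks_cons, big_picks_cons _ _ (fun f v => F f (_ :: v))).
  rewrite addrCA; congr (_ + (_ + _)); apply: eq_bigr => p _.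
  by apply: HF; apply: Permutation.perm_swap.
- by rewrite IH1 ?IH2.
Qed.

Lemma size_picks w : size (picks w) = size w.
Proof. by elim: w => //= a w IH; rewrite size_map IH. Qed.

End Picks.

Lemma mem_picks (T : eqType) (w : seq T) (p : T * seq T) :
  p \in picks w -> Permutation (p.1 :: p.2) w.
Proof.
elim: w p => //= a w IH p; rewrite inE => /orP[/eqP -> //|/mapP[q /IH qw ->]] /=.
by apply: Permutation.perm_trans (Permutation.perm_swap _ _ _) _; apply: Permutation.perm_skip.
Qed.

Lemma size_mem_picks (T : eqType) (w : seq T) (p : T * seq T) :
  p \in picks w -> size w = (size p.2).+1.
Proof. by move/mem_picks/Permutation_length. Qed.

Lemma size_mem_pairs (T : eqType) (w : seq T) (p : T * T * seq T) :
  p \in pairs w -> size w = (size p.2).+2.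
Proof.
elim: w p => //= a w IH p; rewrite mem_cat => /orP[] /mapP[q qw -> /=].
  by rewrite (size_mem_picks qw).
by rewrite (IH _ qw).
Qed.

Lemma sumn_mem_picks (T : eqType) (F : T -> nat) (w : seq T) (p : T * seq T) :
  p \in picks w -> (\sum_(f <- w) F f = F p.1 + \sum_(f <- p.2) F f)%N.
Proof.
elim: w p => //= a w IH p; rewrite big_cons inE => /orP[/eqP -> //|/mapP[q /IH -> ->]] /=.
by rewrite big_cons addnCA.
Qed.

Section Wick.
Variables (T : eqType) (R : realType) (C : T -> T -> R).
Hypothesis CC : forall f g, C f g = C g f.

(** Wick's formula, expanded along the first letter.  [n] bounds the length of the
    word, so that the value 0 is never reached from [wick]. *)
Fixpoint wick_rec n (w : seq T) : R :=
  match w with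
  | [::] => 1
  | f :: w' => if n is n'.+1 then
      \sum_(p <- picks w') C f p.1 * wick_rec n' p.2 else 0
  end.

Definition wick w := wick_rec (size w) w.

Lemma wick_rec_stable n w : (size w <= n)%N -> wick_rec n w = wick w.
Proof.
suff H m : (size w <= n -> size w <= m -> wick_rec n w = wick_rec m w)%N.
  by move=> wn; apply: H.
elim: n m w => [|n IH] [|m] [|f w] //= wn wm.
apply: eq_big_seq => p /size_mem_picks sw; rewrite (IH m) //; lia.
Qed.

Lemma wick_cons f w :
  wick (f :: w) = \sum_(p <- picks w) C f p.1 * wick p.2.
Proof.
rewrite {1}/wick [LHS]/=.
apply: eq_big_seq => p /size_mem_picks sw; rewrite wick_rec_stable //; lia.
Qed.

(** Wick's formula pairs the first letter with each other one, so that its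
    symmetry has to be proved: exchanging the first two letters exchanges two
    successive choices. *)
Lemma Permutation_wick s t : Permutation s t -> wick s = wick t.
Proof.
move=> st; rewrite /wick -(Permutation_length st : size s = size t); move: (size s) => n.
elim: n s t st => [|n IH] s t st.
  by case: s st => [/Permutation_nil->|a s] //; case: t => // /Permutation_sym/Permutation_nil.
elim: st => {s t} [|a s t st _|a b s|s t u st E1 tu E2] //=.
- apply: (Permutation_picks (F := fun g u => C a g * wick_rec n u)) st.
  by move=> b u v uv; rewrite (IH _ _ uv).
- rewrite !(big_picks_cons _ _ (fun g u => C _ g * wick_rec n u)) CC; congr (_ + _).
  case: n {IH} => [|n] /=; first by rewrite !big1 // => p; rewrite mulr0.
  under eq_bigr => p _ do rewrite mulr_sumr.
  under [RHS]eq_bigr => p _ do rewrite mulr_sumr.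
  rewrite (big_picks2_swap s (fun f g v => C b f * (C a g * wick_rec n v))).
  by do 2! (apply: eq_bigr => ? _); rewrite mulrCA.
- exact: etrans E1 E2.
Qed.

Lemma wick_sum_pairs w :
  (size w)%:R * wick w = 2 * \sum_(p <- pairs w) C p.1.1 p.1.2 * wick p.2.
Proof.
transitivity (\sum_(p <- picks w) wick (p.1 :: p.2)).
  rewrite -(size_picks w) -sum1_size natr_sum mulr_suml big_seq [RHS]big_seq.
  by apply: eq_bigr => p /mem_picks/Permutation_wick->; rewrite mul1r.
under eq_bigr => p _ do rewrite wick_cons.
rewrite (big_picks2 w (fun f g v => C f g * wick v)) mulr_sumr.
by apply: eq_bigr => p _; rewrite (CC p.1.2); ring.
Qed.

(** Expanding each summand along its first letter, every unordered pair [f, g]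
    collects [C (D f) g + C f (D g) + c f g = C f g]; summing over unordered pairs
    alone counts each perfect matching [size w / 2] times. *)
Lemma wick_lyapunov (D : T -> T) (c : T -> T -> R) w :
  (forall f g, C f g = C (D f) g + C f (D g) + c f g) ->
  \sum_(p <- picks w) wick (D p.1 :: p.2) +
  \sum_(p <- pairs w) c p.1.1 p.1.2 * wick p.2 = (size w)%:R / 2 * wick w.
Proof.
move=> CE; rewrite mulrAC wick_sum_pairs mulrAC divff ?pnatr_eq0 // mul1r.
under eq_bigr => p _ do rewrite wick_cons.
rewrite (big_picks2 w (fun f g v => C (D f) g * wick v)) -big_split /=.
by apply: eq_bigr => p _; rewrite [in RHS]CE (CC p.1.1 (D _)); ring.
Qed.

(** The recurrence of the moments of a normal law of variance [C f f]. *)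
Lemma wick_nseq f r :
  wick (nseq r.+2 f) = r.+1%:R * (C f f * wick (nseq r f)).
Proof.
rewrite [nseq _ _]/= -[f :: nseq r f]/(nseq r.+1 f) wick_cons.
have -> : picks (nseq r.+1 f) = nseq r.+1 (f, nseq r f).
  by elim: r => [//|r IH]; rewrite -[LHS]/((f, nseq r.+1 f) ::
    [seq (p.1, f :: p.2) | p <- picks (nseq r.+1 f)]) IH map_nseq.
by rewrite big_nseq iter_addr_0 -[LHS]mulr_natl.
Qed.

End Wick.

Section Expand.
Variables (T : eqType) (R : realType).

(** A product of sums expanded by the number of factors [y]: none, one, two, or
    at least three.  The last group only matters through its sizes, so that its
    index set is left unspecified. *)
Lemma prodrD_pairs (w : seq T) : exists rest : seq (seq T * seq T),
  (forall p : seq T * seq T, p \in rest -> (2 < size p.2)%N /\ size w = (size p.1 + size p.2)%N) /\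
  forall x y : T -> R, \prod_(f <- w) (x f + y f) =
    \prod_(f <- w) x f + \sum_(p <- picks w) y p.1 * \prod_(f <- p.2) x f +
    \sum_(p <- pairs w) y p.1.1 * y p.1.2 * \prod_(f <- p.2) x f +
    \sum_(p <- rest) (\prod_(f <- p.2) y f) * \prod_(f <- p.1) x f.
Proof.
elim: w => [|a w [rest [Hr E]]].
  by exists [::]; split=> // x y; rewrite !big_nil !addr0.
exists ([seq (p.2, [:: a; p.1.1; p.1.2]) | p <- pairs w] ++
  [seq (a :: p.1, p.2) | p <- rest] ++ [seq (p.1, a :: p.2) | p <- rest]).
split=> [p|x y].
  rewrite !mem_cat => /or3P[] /mapP[[u v] qr ->] /=.
  - by rewrite (size_mem_pairs qr) /= addn3.
  - by have := Hr _ qr => /= -[]; lia.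
  - by have := Hr _ qr => /= -[]; lia.
rewrite [picks _]/= [pairs _]/= !big_cons E !big_cat !big_map /=.
rewrite (_ : \sum_(p <- picks w) y p.1 * \prod_(f <- a :: p.2) x f =
  x a * \sum_(p <- picks w) y p.1 * \prod_(f <- p.2) x f); last first.
  by rewrite mulr_sumr; apply: eq_bigr => p _; rewrite big_cons mulrCA.
rewrite (_ : \sum_(p <- pairs w) y p.1.1 * y p.1.2 * \prod_(f <- a :: p.2) x f =
  x a * \sum_(p <- pairs w) y p.1.1 * y p.1.2 * \prod_(f <- p.2) x f); last first.
  by rewrite mulr_sumr; apply: eq_bigr => p _; rewrite big_cons mulrCA.
rewrite (_ : \sum_(p <- rest) (\prod_(f <- p.2) y f) * \prod_(f <- a :: p.1) x f =
  x a * \sum_(p <- rest) (\prod_(f <- p.2) y f) * \prod_(f <- p.1) x f); last first.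
  by rewrite mulr_sumr; apply: eq_bigr => p _; rewrite big_cons mulrCA.
rewrite (_ : \sum_(p <- rest) (\prod_(f <- a :: p.2) y f) * \prod_(f <- p.1) x f =
  y a * \sum_(p <- rest) (\prod_(f <- p.2) y f) * \prod_(f <- p.1) x f); last first.
  by rewrite mulr_sumr; apply: eq_bigr => p _; rewrite big_cons mulrA.
rewrite (_ : \sum_(p <- picks w) y a * y p.1 * \prod_(f <- p.2) x f =
  y a * \sum_(p <- picks w) y p.1 * \prod_(f <- p.2) x f); last first.
  by rewrite mulr_sumr; apply: eq_bigr => p _; rewrite mulrA.
rewrite (_ : \sum_(p <- pairs w) (\prod_(f <- [:: a; p.1.1; p.1.2]) y f) *
    \prod_(f <- p.2) x f =
  y a * \sum_(p <- pairs w) y p.1.1 * y p.1.2 * \prod_(f <- p.2) x f); last first.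
  rewrite mulr_sumr; apply: eq_bigr => p _.
  by rewrite !big_cons big_nil mulr1 !mulrA.
ring.
Qed.

End Expand.

(** * The recurrence for the moments of centred degree sums *)

Section Statistics.
Variable R : realType.
Implicit Types (f g p q : {poly R}) (w u v : seq {poly R}).

Definition degree_sum f (m : nat) (t : growth m) : R :=
  \sum_(u < m.+1) f.[(degree (tree_edge t) u)%:R].

(** Centring at [nu f] times the number of nodes, and not at the exact mean,
    makes the increments, given by [drift f], independent of [m]. *)
Definition centered_sum f (m : nat) (t : growth m) : R := degree_sum f t - nu f * m.+1%:R.

Lemma degree_sum_step f m (t : growth m) (v : 'I_m.+1) :
  @degree_sum f m.+1 (t, v) =
  degree_sum f t + (fdiff f).[(degree (tree_edge t) v)%:R] + f.[1].
Proof.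
rewrite /degree_sum big_ord_recr /= degree_new; congr (_ + _).
rewrite (bigD1 v) //= [in RHS](bigD1 v) //= degree_widen eqxx addn1.
rewrite (eq_bigr (fun u : 'I_m.+1 => f.[(degree (tree_edge t) u)%:R])); last first.
  by move=> u uv; rewrite degree_widen (negbTE uv) addn0.
rewrite /fdiff hornerD hornerN horner_comp hornerD hornerX hornerC -natr1; ring.
Qed.

Lemma centered_sum_step f m (t : growth m) (v : 'I_m.+1) :
  @centered_sum f m.+1 (t, v) = centered_sum f t + (drift f).[(degree (tree_edge t) v)%:R].
Proof.
rewrite /centered_sum degree_sum_step /drift hornerD hornerN hornerC -(natr1 m.+1) (nu_fdiff f); ring.
Qed.

(** The family of centred sums is closed under averaging over the attachment
    point: this is what closes the recurrence for the moments. *)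
Lemma uniform_horner q m (t : growth m) :
  m.+1%:R^-1 * (\sum_(v < m.+1) q.[(degree (tree_edge t) v)%:R]) =
  nu q + centered_sum q t / m.+1%:R.
Proof. by rewrite /centered_sum /degree_sum mulrBl mulfK ?pnatr_eq0 // addrC subrK mulrC. Qed.

Definition moment w (m : nat) : R :=
  tree_mean (fun t : growth m => \prod_(f <- w) centered_sum f t).

(** The mean of [\prod_(f <- u) centered_sum f * q(d_v)], with [v] uniform; see
    [mean_attach]. *)
Definition moment_attach u q (m : nat) : R :=
  nu q * moment u m + moment (q :: u) m / m.+1%:R.

Lemma mean_attach u q m :
  tree_mean (fun t : growth m => m.+1%:R^-1 *
    (\sum_(v < m.+1) q.[(degree (tree_edge t) v)%:R] * \prod_(f <- u) centered_sum f t))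
  = moment_attach u q m.
Proof.
rewrite /moment_attach /moment [_ / _]mulrC -!tree_meanZ -tree_meanD.
apply: eq_tree_mean => t; rewrite -mulr_suml mulrA uniform_horner big_cons; ring.
Qed.

Lemma momentS w : exists rest : seq (seq {poly R} * seq {poly R}),
  (forall p : seq {poly R} * seq {poly R}, p \in rest ->
     (2 < size p.2)%N /\ size w = (size p.1 + size p.2)%N) /\
  forall m, moment w m.+1 = moment w m +
    \sum_(p <- picks w) moment_attach p.2 (drift p.1) m +
    \sum_(p <- pairs w) moment_attach p.2 (drift p.1.1 * drift p.1.2) m +
    \sum_(p <- rest) moment_attach p.1 (\prod_(f <- p.2) drift f) m.
Proof.
have [rest [Hr E]] := prodrD_pairs R w.
exists rest; split=> // m.
rewrite {1}/moment tree_meanS.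
under eq_bigr => p _ do rewrite -mean_attach.
under [X in _ + _ + X + _]eq_bigr => p _ do rewrite -mean_attach.
under [X in _ + _ + _ + X]eq_bigr => p _ do rewrite -mean_attach.
rewrite -!tree_mean_sum -!tree_meanD; apply: eq_tree_mean => t.
rewrite -!mulr_sumr -[\prod_(f <- w) centered_sum f t](@mulKf _ m.+1%:R) ?pnatr_eq0 //.
rewrite -!mulrDr; congr (_ * _).
rewrite [\sum_(p <- picks w) _]exchange_big [\sum_(p <- pairs w) _]exchange_big.
rewrite [\sum_(p <- rest) _]exchange_big /= mulr_natl.
have -> : \prod_(f <- w) centered_sum f t *+ m.+1 =
    \sum_(v < m.+1) \prod_(f <- w) centered_sum f t by rewrite sumr_const card_ord.
rewrite -!big_split /=; apply: eq_bigr => v _.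
rewrite (eq_bigr (fun f => centered_sum f t + (drift f).[(degree (tree_edge t) v)%:R])).
  rewrite E; congr (_ + _ + _ + _).
    by apply: eq_bigr => p _; rewrite hornerM.
  by apply: eq_bigr => p _; rewrite horner_prod.
by move=> f _; rewrite centered_sum_step.
Qed.

End Statistics.

(** * A Stolz-Cesaro theorem at the scale of powers of the square root *)

Section Asymptotics.
Variable R : realType.

(** Beyond some index the increments of [a - l * b] are at most [e / 2] times
    those of [b]; summing them, the initial error is absorbed because [b] is
    unbounded. *)
Lemma stolz (a b : nat -> R) (l : R) :
  (forall m, b m < b m.+1) -> b m @[m --> \oo] --> +oo ->
  (a m.+1 - a m) / (b m.+1 - b m) @[m --> \oo] --> l ->
  a m / b m @[m --> \oo] --> l.
Proof.
move=> b_lt b_oo /cvgrPdist_le ab; apply/cvgrPdist_le => e e0.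
have e2 : 0 < e / 2 by rewrite divr_gt0.
have [N _ HN] := ab _ e2.
have step i : `|a (N + i)%N - l * b (N + i)%N| <=
    `|a N - l * b N| + e / 2 * (b (N + i)%N - b N).
  elim: i => [|i IH]; first by rewrite addn0 subrr mulr0 addr0.
  have d0 : 0 < b (N + i).+1 - b (N + i)%N by rewrite subr_gt0.
  have H : `|l * (b (N + i).+1 - b (N + i)%N) - (a (N + i).+1 - a (N + i)%N)| <=
      e / 2 * (b (N + i).+1 - b (N + i)%N).
    rewrite (_ : l * _ - _ = (l - (a (N + i).+1 - a (N + i)%N) /
      (b (N + i).+1 - b (N + i)%N)) * (b (N + i).+1 - b (N + i)%N)).
      by rewrite normrM (gtr0_norm d0) ler_pM2r //; apply: HN; exact: leq_addr.
    by rewrite [RHS]mulrBl divfK ?gt_eqF.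
  rewrite addnS.
  rewrite (_ : a (N + i).+1 - _ = (a (N + i)%N - l * b (N + i)%N) -
    (l * (b (N + i).+1 - b (N + i)%N) - (a (N + i).+1 - a (N + i)%N))); last ring.
  apply: le_trans (ler_normB _ _) _; lra.
move/cvgryPge: b_oo => /(_ (Num.max 1 ((`|a N - l * b N| - e / 2 * b N) / (e / 2)))) b_oo.
near=> m.
have : Num.max 1 ((`|a N - l * b N| - e / 2 * b N) / (e / 2)) <= b m by near: m.
rewrite ge_max ler_pdivrMr // => /andP[b1 bm].
have bm0 : 0 < b m by apply: lt_le_trans b1.
have Nm : (N <= m)%N by near: m; exact: nbhs_infty_ge.
have := step (m - N)%N; rewrite subnKC // => H.
rewrite (_ : l - a m / b m = - ((a m - l * b m) / b m)); last by field; rewrite gt_eqF.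
rewrite normrN normrM normfV (gtr0_norm bm0) ler_pdivrMr //; lra.
Unshelve. all: end_near. Qed.

Definition sqrt_size (m : nat) : R := Num.sqrt m.+1%:R.

Lemma sqrt_size_gt0 m : 0 < sqrt_size m. Proof. by rewrite sqrtr_gt0. Qed.

Lemma sqr_sqrt_size m : sqrt_size m ^+ 2 = m.+1%:R. Proof. by rewrite sqr_sqrtr. Qed.

Lemma sqrt_size_lt m : sqrt_size m < sqrt_size m.+1. Proof. by rewrite ltr_sqrt // ltr_nat. Qed.

Lemma cvg_sqrt_size_ratio : sqrt_size m.+1 / sqrt_size m @[m --> \oo] --> (1 : R).
Proof.
apply: (@squeeze_cvgr _ _ _ _ (fun=> 1) (fun m => 1 + @harmonic R m)).
- near=> m; apply/andP.
  have r1 : 1 <= sqrt_size m.+1 / sqrt_size m by rewrite ler_pdivlMr ?sqrt_size_gt0 // mul1r ltW // sqrt_size_lt.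
  split=> //; rewrite (_ : 1 + harmonic m = (sqrt_size m.+1 / sqrt_size m) ^+ 2).
    by rewrite expr2 ler_peMr // (le_trans _ r1).
  rewrite expr_div_n !sqr_sqrt_size -[m.+2%:R]natr1 mulrDl divff ?pnatr_eq0 //.
  by rewrite mul1r.
- exact: cvg_cst.
- rewrite -[X in _ --> X]addr0; apply: cvgD; [exact: cvg_cst|exact: cvg_harmonic].
Unshelve. all: end_near. Qed.

Lemma cvg_sqrt_sizeV : (sqrt_size m)^-1 @[m --> \oo] --> (0 : R).
Proof.
apply/cvgrPdist_le => e e0; near=> m.
rewrite sub0r normrN gtr0_norm ?invr_gt0 ?sqrt_size_gt0 //.
rewrite invf_ple ?posrE ?sqrt_size_gt0 // -(@ler_pXn2r _ 2) ?nnegrE ?invr_ge0 ?ltW ?sqrt_size_gt0 //.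
rewrite sqr_sqrt_size -(natr1 m) ltr_pwDr //; near: m; exact: nbhs_infty_ger.
Unshelve. all: end_near. Qed.

Lemma cvg_sqrt_size_pow r : (0 < r)%N -> sqrt_size m ^+ r @[m --> \oo] --> +oo.
Proof.
move=> r0; apply/cvgryPge => A; near=> m.
have s1 : 1 <= sqrt_size m by rewrite -sqrtr1 ler_sqrt // ler1n.
apply: (@le_trans _ _ (sqrt_size m)); last by rewrite -{1}[sqrt_size m]expr1 ler_weXn2l.
have [A0|A0] := leP A 0; first by rewrite (le_trans A0) // ltW ?sqrt_size_gt0.
rewrite -(@ler_pXn2r _ 2) ?nnegrE ?ltW ?sqrt_size_gt0 //.
rewrite sqr_sqrt_size -(natr1 m) ltr_pwDr //; near: m; exact: nbhs_infty_ger.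
Unshelve. all: end_near. Qed.

Lemma cvg_expr (u : nat -> R) (l : R) r :
  u m @[m --> \oo] --> l -> u m ^+ r @[m --> \oo] --> l ^+ r.
Proof. by move=> ul; apply: (@cvg_comp _ _ _ u (fun x => x ^+ r)) ul _; exact: exprn_continuous. Qed.

(** The increments of [sqrt_size m ^+ r] are equivalent to
    [(r / 2) * sqrt_size m ^+ r / m.+1]. *)
Lemma stolz_sqrt_size r (x : nat -> R) (l : R) : (0 < r)%N ->
  m.+1%:R * (x m.+1 - x m) / sqrt_size m ^+ r @[m --> \oo] --> r%:R / 2 * l ->
  x m / sqrt_size m ^+ r @[m --> \oo] --> l.
Proof.
move=> r0 xl; apply: stolz.
- by move=> m; rewrite ltr_pXn2r ?nnegrE ?ltW ?sqrt_size_gt0 // sqrt_size_lt.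
- exact: cvg_sqrt_size_pow.
have r2 : r%:R / 2 != 0 :> R by rewrite mulf_neq0 ?invr_eq0 ?pnatr_eq0 // -lt0n.
have dsq : m.+1%:R * (sqrt_size m.+1 ^+ r - sqrt_size m ^+ r) / sqrt_size m ^+ r @[m --> \oo] --> (r%:R / 2 : R).
  have -> : (fun m => m.+1%:R * (sqrt_size m.+1 ^+ r - sqrt_size m ^+ r) / sqrt_size m ^+ r) =
      (fun m => (\sum_(i < r) (sqrt_size m.+1 / sqrt_size m) ^+ i) / (sqrt_size m.+1 / sqrt_size m + 1)).
    apply/funext => m; have s0 := sqrt_size_gt0 m; have s1 := sqrt_size_gt0 m.+1.
    set q := sqrt_size m.+1 / sqrt_size m.
    have q1 : 0 < q + 1 by rewrite addr_gt0 // divr_gt0.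
    (* [q^2 = m.+2 / m.+1], so that [m.+1 * (q^2 - 1)] is exactly 1. *)
    have qq : m.+1%:R * (q - 1) * (q + 1) = 1.
      rewrite -mulrA -subr_sqr expr1n expr_div_n !sqr_sqrt_size.
      rewrite mulrBr mulrCA divff ?pnatr_eq0 // !mulr1.
      by rewrite -[m.+2%:R]natr1 addrAC subrr add0r.
    rewrite -mulrA mulrBl divff ?expf_neq0 ?gt_eqF // -expr_div_n -/q subrX1.
    apply: (mulIf (lt0r_neq0 q1)); rewrite divfK ?gt_eqF //.
    by rewrite mulrA mulrAC qq mul1r.
  have -> : r%:R / 2 = (\sum_(i < r) 1 ^+ i) / (1 + 1) :> R.
    by under eq_bigr do rewrite expr1n; rewrite sumr_const card_ord.
  apply: cvgM; first by apply: cvg_big => [|i _]; [exact: add_continuous|]; apply: cvg_expr; exact: cvg_sqrt_size_ratio.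
  apply: cvgV; first by rewrite (pnatr_eq0 R 2).
  by apply: cvgD; [exact: cvg_sqrt_size_ratio|exact: cvg_cst].
have -> : (fun m => (x m.+1 - x m) / (sqrt_size m.+1 ^+ r - sqrt_size m ^+ r)) =
  (fun m => (m.+1%:R * (x m.+1 - x m) / sqrt_size m ^+ r) /
            (m.+1%:R * (sqrt_size m.+1 ^+ r - sqrt_size m ^+ r) / sqrt_size m ^+ r)).
  apply/funext => m; have s0 := sqrt_size_gt0 m.
  have d0 : sqrt_size m.+1 ^+ r - sqrt_size m ^+ r != 0.
    by rewrite gt_eqF // subr_gt0 ltr_pXn2r ?nnegrE ?ltW ?sqrt_size_gt0 // sqrt_size_lt.
  have m0 : m.+1%:R != 0 :> R by rewrite pnatr_eq0.
  rewrite -(mulrA _ (x m.+1 - x m)) -(mulrA _ (sqrt_size m.+1 ^+ r - _)) -mulf_div divff // mul1r.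
  by rewrite -mulf_div divff ?mulr1 // invr_eq0 expf_neq0 // gt_eqF.
rewrite (_ : l = r%:R / 2 * l / (r%:R / 2)); last by rewrite mulrAC divff ?mul1r.
by apply: cvgM xl _; apply: cvgV.
Qed.

End Asymptotics.

(** * Convergence of the normalized moments *)

Section MomentLimit.
Variable R : realType.
Implicit Types (f g q : {poly R}) (w u : seq {poly R}).

Lemma cvg_sum_seq (I : eqType) (s : seq I) (F : I -> nat -> R) (l : I -> R) :
  (forall i, i \in s -> F i m @[m --> \oo] --> l i) ->
  \sum_(i <- s) F i m @[m --> \oo] --> \sum_(i <- s) l i.
Proof.
move=> Fl; rewrite big_seq.
rewrite (_ : (fun m => _) = (fun m => \sum_(i <- s | i \in s) F i m)).
  by apply: cvg_big => [|i /Fl //]; exact: add_continuous.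
by apply/funext => m; rewrite big_seq.
Qed.

Definition normalized_moment w m : R := moment w m / sqrt_size R m ^+ size w.

(** [b.+2] counts the letters that were replaced by increments.  Since
    [m.+1 = sqrt_size m ^+ 2], two of them compensate the factor [m.+1] and each further
    one costs a factor [sqrt_size m]; the limit is thus nonzero only for [b = 0], that
    is, when [0 ^+ b] is 1. *)
Lemma cvg_attach u q b (a a' : R) :
  normalized_moment u m @[m --> \oo] --> a ->
  normalized_moment (q :: u) m @[m --> \oo] --> a' ->
  m.+1%:R * moment_attach u q m / sqrt_size R m ^+ (size u + b.+2) @[m --> \oo] -->
    nu q * a * 0 ^+ b.
Proof.
move=> ua qa.
have -> : (fun m => m.+1%:R * moment_attach u q m / sqrt_size R m ^+ (size u + b.+2)) =
  (fun m => (nu q * normalized_moment u m + normalized_moment (q :: u) m * (sqrt_size R m)^-1)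
            * (sqrt_size R m)^-1 ^+ b).
  apply/funext => m; rewrite /moment_attach /normalized_moment /= -sqr_sqrt_size.
  have := sqrt_size_gt0 R m; set s := sqrt_size R m => s0.
  rewrite (exprD s (size u)) -[b.+2]addn2 (exprD s b) [s ^+ (size u).+1]exprS.
  have -> : s^-1 ^+ b = (s ^+ b)^-1 by rewrite exprVn.
  have : s ^+ b != 0 by rewrite expf_neq0 // gt_eqF.
  have : s ^+ size u != 0 by rewrite expf_neq0 // gt_eqF.
  move: (s ^+ b) (s ^+ size u) => x y y0 x0.
  by field; rewrite x0 y0 gt_eqF.
have -> : nu q * a = nu q * a + a' * 0 by rewrite mulr0 addr0.
apply: cvgM; last by apply: cvg_expr; exact: cvg_sqrt_sizeV.
apply: cvgD; first by apply: cvgM ua; exact: cvg_cst.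
by apply: cvgM qa _; exact: cvg_sqrt_sizeV.
Qed.

Lemma moment_drift_small f u m : (size f <= 1)%N -> moment (drift f :: u) m = 0.
Proof.
move=> f1; rewrite /moment -(tree_mean_cst m 0); apply: eq_tree_mean => t.
rewrite big_cons drift_small // /centered_sum /degree_sum -polyC0 nuC mul0r subr0 big1 ?mul0r //.
by move=> v _; rewrite hornerC.
Qed.

Lemma wick_drift_small f u : (size f <= 1)%N -> wick (@cov R) (drift f :: u) = 0.
Proof.
move=> f1; rewrite wick_cons big1 // => p _.
by rewrite cov_small ?mul0r // drift_small // size_poly0.
Qed.

(** The terms with at least two increments involve shorter words; the terms with
    one increment have a word of the same length in which [drift] has lowered a
    degree. *)
Theorem cvg_normalized_moment w :
  normalized_moment w m @[m --> \oo] --> wick (@cov R) w.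
Proof.
elim/ltn_ind: {w}(size w) {-2}w (erefl (size w)) => r IHr w wr.
elim/ltn_ind: {w}(\sum_(f <- w) size f)%N {-2}w (erefl (\sum_(f <- w) size f)%N) wr
  => N IHN w wN wr.
case: (posnP r) => [r0|r0].
  rewrite (_ : w = [::]); last by apply: size0nil; rewrite wr.
  rewrite (_ : normalized_moment _ = fun=> 1); first exact: cvg_cst.
  apply/funext => m; rewrite /normalized_moment expr0 divr1 -[RHS](tree_mean_cst m 1).
  by apply: eq_tree_mean => t; rewrite big_nil.
rewrite /normalized_moment wr; apply: stolz_sqrt_size => //.
have [rest [Hr E]] := momentS w.
rewrite -wr -(wick_lyapunov (@covC R) w (@covE R)).
pose A m := \sum_(p <- picks w) normalized_moment (drift p.1 :: p.2) m.
pose B m := \sum_(p <- pairs w)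
  m.+1%:R * moment_attach p.2 (drift p.1.1 * drift p.1.2) m / sqrt_size R m ^+ size w.
pose C m := \sum_(p <- rest)
  m.+1%:R * moment_attach p.1 (\prod_(f <- p.2) drift f) m / sqrt_size R m ^+ size w.
have -> : (fun m => m.+1%:R * (moment w m.+1 - moment w m) / sqrt_size R m ^+ size w) =
    (fun m => A m + B m + C m).
  apply/funext => m; have addK4 (a b c d : R) : a + b + c + d - a = b + c + d by ring.
  rewrite E addK4 !mulrDr !mulrDl /B /C -!mulr_suml -!mulr_sumr; congr (_ + _ + _).
  rewrite /A mulr_sumr mulr_suml big_seq [RHS]big_seq; apply: eq_bigr => p pw.
  rewrite /moment_attach nu_drift mul0r add0r /normalized_moment /=.
  by rewrite -(size_mem_picks pw) mulrCA divff ?pnatr_eq0 // mulr1.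
rewrite -[X in _ --> X]addr0.
apply: cvgD; first apply: cvgD.
- apply: cvg_sum_seq => p pw; have [p1|p1] := leqP (size p.1) 1.
    rewrite wick_drift_small // (_ : normalized_moment _ = fun=> 0).
      exact: cvg_cst.
    by apply/funext => m; rewrite /normalized_moment moment_drift_small // mul0r.
  have sp := size_mem_picks pw.
  apply: (IHN _ _ _ erefl); last by rewrite -wr sp.
  rewrite -wN big_cons (sumn_mem_picks _ pw).
  by rewrite ltn_add2r (leq_ltn_trans (size_drift _)) // prednK // ltnW.
- apply: cvg_sum_seq => p pw; have sp := size_mem_pairs pw.
  rewrite sp -addn2.
  have -> : increment_cov p.1.1 p.1.2 * wick (@cov R) p.2 =
      nu (drift p.1.1 * drift p.1.2) * wick (@cov R) p.2 * 0 ^+ 0.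
    by rewrite expr0 mulr1.
  apply: (@cvg_attach _ _ 0 _ (wick (@cov R) (drift p.1.1 * drift p.1.2 :: p.2))).
    by apply: IHr (erefl _); rewrite -wr sp.
  by apply: IHr (erefl _); rewrite -wr sp.
- rewrite (_ : 0 = \sum_(p <- rest) 0); last by rewrite big1.
  apply: cvg_sum_seq => -[u v] /Hr[/= v2 sp].
  rewrite (_ : size w = size u + (size v - 3).+3)%N; last by rewrite sp -addn3 subnK.
  have -> : 0 = nu (\prod_(f <- v) drift f) * wick (@cov R) u
      * 0 ^+ (size v - 3).+1 by rewrite expr0n mulr0.
  apply: (@cvg_attach _ _ _ _
      (wick (@cov R) (\prod_(f <- v) drift f :: u))).
    by apply: IHr (erefl _); rewrite -wr sp -[X in (X < _)%N]addn0 ltn_add2l (ltn_trans _ v2).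
  by apply: IHr (erefl _); rewrite -wr sp /= -addn1 ltn_add2l (ltn_trans _ v2).
Qed.

End MomentLimit.

(** * Moments of the root degree *)

Section RootDegree.
Variable R : realType.

Lemma degree_root_step m (t : growth m) (v : 'I_m.+1) :
  degree (@tree_edge m.+1 (t, v)) ord0 =
  (degree (tree_edge t) ord0 + (v == ord0))%N.
Proof.
rewrite -[ord0](_ : widen_ord (leqnSn _) ord0 = _); last exact: val_inj.
by rewrite degree_widen eq_sym.
Qed.

(** The induction needs constants [c s] with [1 + 2 * c s <= c s.+1]; powers of 3
    are a simple choice. *)
Lemma exprD1_le (x : R) s : 1 <= x -> (x + 1) ^+ s.+1 <= x ^+ s.+1 + 3 ^+ s.+1 * x ^+ s.
Proof.
move=> x1; have x0 : 0 <= x by lra.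
elim: s => [|s IH]; first by rewrite !expr1 expr0 mulr1; lra.
rewrite exprS; apply: le_trans (ler_wpM2l _ IH) _; first lra.
rewrite ![x ^+ _.+1]exprS (exprS 3 s.+1).
have a1 : 1 <= 3 ^+ s.+1 :> R by rewrite exprn_ege1 //; lra.
have b0 : 0 <= x ^+ s by rewrite exprn_ge0.
move: (3 ^+ s.+1) (x ^+ s) a1 b0 => a b a1 b0.
have ab : 0 <= (a - 1) * (x * b) by rewrite mulr_ge0 ?mulr_ge0 //; lra.
have xb : 0 <= (x - 1) * (a * b) by rewrite mulr_ge0 ?mulr_ge0 //; lra.
nra.
Qed.

(** The leading 1 is the value of [d + 1] for the tree with one node, where the
    recurrence of [root_moment_le] starts. *)
Definition harmonic_sum (m : nat) : R := 1 + \sum_(i < m) i.+1%:R^-1.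

Lemma harmonic_sum_ge1 m : 1 <= harmonic_sum m.
Proof. by rewrite lerDl sumr_ge0. Qed.

(** The last term is compared with an increment of the logarithm,
    [1 / (m + 2) <= ln (m + 2) - ln (m + 1)]. *)
Lemma harmonic_sum_le m : harmonic_sum m.+1 <= 2 + ln m.+1%:R.
Proof.
elim: m => [|m IH].
  by rewrite /harmonic_sum big_ord1 invr1 ln1; lra.
rewrite /harmonic_sum big_ord_recr /= addrA -/(harmonic_sum m.+1).
suff : m.+2%:R^-1 <= ln m.+2%:R - ln m.+1%:R :> R.
  by move=> H; apply: le_trans (lerD IH H) _; rewrite -addrA lerD2l addrC subrK.
rewrite -[X in _ <= X]opprB -ln_div ?posrE // lerNr.
have -> : m.+1%:R / m.+2%:R = 1 + - m.+2%:R^-1 :> R.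
  have n0 : m.+2%:R != 0 :> R by rewrite pnatr_eq0.
  have n1 : m.+1%:R = m.+2%:R - 1 :> R by rewrite -[m.+2%:R]natr1 addrK.
  by rewrite n1 mulrBl divff // mul1r.
by apply: le_ln1Dx; rewrite ltrN2 invf_lt1 // ltr1n.
Qed.

(** The mean of [(d + 1)^s] grows by at most a constant times the mean of
    [(d + 1)^(s-1)] divided by the number of nodes, so that each unit of [s] costs
    one harmonic sum. *)
Lemma root_moment_le s : exists2 K : R, 0 <= K & forall m,
  tree_mean (fun t : growth m => ((degree (tree_edge t) ord0)%:R + 1) ^+ s)
    <= K * harmonic_sum m ^+ s.
Proof.
elim: s => [|s [K K0 HK]].
  exists 1 => // m; rewrite expr0 mulr1 -[X in _ <= X](tree_mean_cst m 1).
  by apply: ler_tree_mean => t; rewrite expr0.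
have K3 : 0 <= 3 ^+ s.+1 * K by rewrite mulr_ge0 // exprn_ge0.
exists (1 + 3 ^+ s.+1 * K); first by rewrite addr_ge0.
elim=> [|m IH].
  rewrite /harmonic_sum big_ord0 addr0 expr1n mulr1.
  apply: (@le_trans _ _ 1); last by rewrite lerDl.
  rewrite -[X in _ <= X](tree_mean_cst 0 1); apply: ler_tree_mean => t.
  rewrite (_ : degree _ _ = 0%N) ?add0r ?expr1n //.
  by rewrite degreeE big1.
rewrite tree_meanS.
set E := tree_mean _ in IH.
apply: (@le_trans _ _ (E + m.+1%:R^-1 * (3 ^+ s.+1 * (K * harmonic_sum m ^+ s)))).
  have HE := HK m; set F := tree_mean _ in HE.
  apply: (@le_trans _ _ (E + m.+1%:R^-1 * (3 ^+ s.+1 * F))); last first.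
    by rewrite lerD2l; do 2! (apply: ler_wpM2l; rewrite ?invr_ge0 ?exprn_ge0 //).
  rewrite /E /F -!tree_meanZ -tree_meanD; apply: ler_tree_mean => t.
  set d := (degree _ _)%:R + 1.
  have d1 : 1 <= d by rewrite lerDr.
  rewrite (bigD1 ord0) //= (eq_bigr (fun=> d ^+ s.+1)); last first.
    by move=> v v0; rewrite degree_root_step (negbTE v0) addn0.
  rewrite degree_root_step eqxx addn1 -[(degree _ _).+1%:R]natr1 -/d sumr_const cardC1 card_ord.
  rewrite -[X in _ <= X + _](@mulKf _ m.+1%:R) ?pnatr_eq0 // -mulrDr.
  rewrite ler_wpM2l ?invr_ge0 // -[m.+1%:R]natr1 mulrDl mul1r -mulr_natl /=.
  by have := exprD1_le s d1; lra.
rewrite /harmonic_sum big_ord_recr /= addrA -/(harmonic_sum m).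
set h := m.+1%:R^-1; have h0 : 0 <= h by rewrite invr_ge0.
have H1 := harmonic_sum_ge1 m; set H := harmonic_sum m in H1 IH *.
have Hs : 0 <= H ^+ s by rewrite exprn_ge0 //; lra.
have L : H ^+ s.+1 + h * H ^+ s <= (H + h) ^+ s.+1.
  rewrite !exprS -mulrDl ler_wpM2l //; first lra.
  by rewrite lerXn2r ?nnegrE //; lra.
apply: le_trans (_ : (1 + 3 ^+ s.+1 * K) * (H ^+ s.+1 + h * H ^+ s) <= _); last first.
  by rewrite ler_wpM2l //; lra.
have : 0 <= h * H ^+ s by rewrite mulr_ge0.
move: (3 ^+ s.+1) IH => c; nra.
Qed.

End RootDegree.

(** * Moments of the Zagreb index *)

Section Conclusion.
Variables (R : realType) (k : nat).

Let f : {poly R} := 'X^k.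

Lemma Zagreb_degree_sum m (t : growth m) :
  Zagreb_index R k (n := m.+1) t = degree_sum f t.
Proof.
rewrite /Zagreb_index /zagreb /degree_sum natr_sum; apply: eq_bigr => v _.
by rewrite /f hornerXn natrX.
Qed.

Lemma Zagreb_bar_centered_sum m (t : growth m) :
  Zagreb_bar R k (n := m.+1) t = centered_sum f t - moment [:: f] m.
Proof.
rewrite /Zagreb_bar Zagreb_degree_sum.
have -> : expect (@Zagreb_index R k m.+1) = moment [:: f] m + nu f * m.+1%:R.
  rewrite -[X in _ = _ + X](tree_mean_cst m) -tree_meanD.
  by apply: eq_tree_mean => s; rewrite big_seq1 subrK Zagreb_degree_sum.
by rewrite /centered_sum; ring.
Qed.

Definition Zbar_moment r m : R :=
  tree_mean (fun t : growth m => Zagreb_bar R k (n := m.+1) t ^+ r).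

Lemma moment_nseq r m :
  moment (nseq r f) m = tree_mean (fun t : growth m => centered_sum f t ^+ r).
Proof. by apply: eq_tree_mean => t; rewrite big_nseq iter_mulr_1. Qed.

(** In the binomial expansion of [Zagreb_bar_centered_sum] to the power [r] only
    the first term survives: the word [[:: f]] has limit 0 by Wick's formula. *)
Lemma cvg_Zbar_moment r :
  Zbar_moment r m / sqrt_size R m ^+ r @[m --> \oo] --> wick (@cov R) (nseq r f).
Proof.
pose c m := normalized_moment [:: f] m.
have c0 : c m @[m --> \oo] --> (0 : R).
  have := @cvg_normalized_moment R [:: f].
  by rewrite wick_cons big_nil; apply.
have -> : (fun m => Zbar_moment r m / sqrt_size R m ^+ r) = (fun m =>
  \sum_(i < r.+1) (-1) ^+ i *+ 'C(r, i) * (normalized_moment (nseq (r - i) f) m * c m ^+ i)).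
  apply/funext => m; rewrite mulrC -tree_meanZ.
  rewrite (eq_bigr (fun i : 'I_r.+1 => tree_mean (fun t : growth m =>
    (sqrt_size R m ^+ r)^-1 * (((-1) ^+ i * centered_sum f t ^+ (r - i) * moment [:: f] m ^+ i) *+ 'C(r, i))))).
    rewrite -tree_mean_sum; apply: eq_tree_mean => t.
    by rewrite Zagreb_bar_centered_sum exprBn mulr_sumr.
  move=> i _; have ir : (i <= r)%N by rewrite -ltnS.
  rewrite /c /normalized_moment moment_nseq size_nseq expr1 expr_div_n.
  have -> : sqrt_size R m ^+ r = sqrt_size R m ^+ (r - i) * sqrt_size R m ^+ i by rewrite -exprD subnK.
  rewrite invfM -[tree_mean (fun t => centered_sum f t ^+ (r - i)) / _]mulrC.
  rewrite -tree_meanZ [_ * (moment _ _ ^+ i / _)]mulrC -!tree_meanZ.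
  by apply: eq_tree_mean => t; rewrite !(mulrnAl, mulrnAr); congr (_ *+ _); ring.
have -> : wick (@cov R) (nseq r f) = \sum_(i < r.+1) (-1) ^+ i *+ 'C(r, i) *
    (wick (@cov R) (nseq (r - i) f) * 0 ^+ i).
  rewrite big_ord_recl big1 => [|i _].
    by rewrite subn0 bin0 mulr1n !expr0 !(mul1r, mulr1) addr0.
  by rewrite expr0n /= !mulr0.
apply: cvg_sum_seq => i _; apply: cvgM; first exact: cvg_cst.
by apply: cvgM; [exact: cvg_normalized_moment|exact: cvg_expr].
Qed.

(** [cov f f] is the limit of the normalized variances. *)
Lemma cov_ge0 : 0 <= cov f f.
Proof.
have := @cvg_Zbar_moment 2; rewrite wick_nseq mul1r mulr1 => /cvgr_to_ge; apply.
near=> m; apply: mulr_ge0; last by rewrite invr_ge0 exprn_ge0 // ltW // sqrt_size_gt0.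
rewrite /Zbar_moment -[X in X <= _](tree_mean_cst m 0).
by apply: ler_tree_mean => t; exact: sqr_ge0.
Unshelve. all: end_near. Qed.

Lemma gauss_momentSS r : gauss_moment R r.+2 = r.+1%:R * gauss_moment R r.
Proof.
rewrite /gauss_moment /= negbK; have [ro|re] := ifPn; first by rewrite mulr0.
have e : r.+2 = (2 * r./2.+1)%N by have := odd_double_half r; rewrite (negbTE re); lia.
rewrite !factS !natrM e natrM exprS.
have : (r./2)`!%:R != 0 :> R by rewrite pnatr_eq0 -lt0n fact_gt0.
have : 2 ^+ r./2 != 0 :> R by rewrite expf_neq0 // pnatr_eq0.
have : (r./2).+1%:R != 0 :> R by rewrite pnatr_eq0.
move: (r./2)`!%:R (2 ^+ r./2) (r./2).+1%:R => x y z z0 y0 x0.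
by field; rewrite x0 y0 z0.
Qed.

Definition Zbar_scale : R := Num.sqrt (cov f f).

Lemma wick_gauss r :
  wick (@cov R) (nseq r f) = gauss_moment R r * Zbar_scale ^+ r.
Proof.
elim/ltn_ind: r => -[|[|r]] IH.
- by rewrite /gauss_moment /= !expr0 !fact0 !mulr1 divr1.
- by rewrite /gauss_moment /= wick_cons big_nil mul0r.
rewrite wick_nseq gauss_momentSS IH // -addn2 exprD sqr_sqrtr ?cov_ge0 //; ring.
Qed.

Lemma powR_half n r : (n%:R : R) `^ (r%:R / 2) = Num.sqrt n%:R ^+ r.
Proof. by rewrite mulrC powRrM powR12_sqrt // powR_mulrn. Qed.

Lemma cvg_Zagreb_bar r :
  expect (fun t : rec_tree n => Zagreb_bar R k t ^+ r) / n%:R `^ (r%:R / 2)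
    @[n --> \oo] --> gauss_moment R r * Zbar_scale ^+ r.
Proof.
rewrite -cvg_shiftS -wick_gauss.
rewrite (_ : (fun n => _) = (fun m => Zbar_moment r m / sqrt_size R m ^+ r)).
  exact: cvg_Zbar_moment.
by apply/funext => m; rewrite /= powR_half.
Qed.

(** Young's inequality with weight [n^(r/2)] balances the moment of order [2r] of
    the Zagreb index, [O(n^r)], against that of order [2s] of the root degree,
    [O(log^(2s) n)]. *)
Lemma Ohat_Zagreb_bar r s :
  Ohat (fun n => expect (fun t : rec_tree n =>
    Zagreb_bar R k t ^+ r * root_degree R t ^+ s)) (r%:R / 2).
Proof.
exists (s * 2)%N; apply/eqO_exP.
have [K K0 HK] := root_moment_le R (s * 2).
pose B : R := `|wick (@cov R) (nseq (r * 2) f)| + 1.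
have B0 : 0 < B by rewrite ltr_wpDl.
have K3 : 0 <= K * 3 ^+ (s * 2) by rewrite mulr_ge0 ?exprn_ge0.
exists (B + K * 3 ^+ (s * 2)); first by rewrite ltr_pwDl.
have bound m : 1 <= ln m.+2%:R :> R ->
  `|Zbar_moment (r * 2) m.+1 / sqrt_size R m.+1 ^+ (r * 2)| <= B ->
  `|tree_mean (fun t : growth m.+1 =>
      Zagreb_bar R k (n := m.+2) t ^+ r * root_degree R (n := m.+2) t ^+ s)| <=
  (B + K * 3 ^+ (s * 2)) * (sqrt_size R m.+1 ^+ r * ln m.+2%:R ^+ (s * 2)).
  move=> l1 HB; set l := ln _ in l1 *.
  have := sqrt_size_gt0 R m.+1; set q := sqrt_size R m.+1 in HB * => q0.
  have qr0 : 0 < q ^+ r by rewrite exprn_gt0.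
  have Q : tree_mean (fun t : growth m.+1 => root_degree R (n := m.+2) t ^+ (s * 2)) <=
      K * 3 ^+ (s * 2) * l ^+ (s * 2).
    apply: le_trans (_ : K * harmonic_sum R m.+1 ^+ (s * 2) <= _).
      apply: le_trans (HK m.+1); apply: ler_tree_mean => t.
      by rewrite lerXn2r ?nnegrE ?lerDl ?addr_ge0.
    rewrite -mulrA ler_wpM2l // -exprMn lerXn2r ?nnegrE //.
    - by apply: le_trans (harmonic_sum_ge1 _ _).
    - by rewrite mulr_ge0 //; lra.
    apply: le_trans (harmonic_sum_le _ _) _.
    have : ln m.+1%:R <= l by rewrite /l ler_ln ?posrE // ler_nat.
    lra.
  have Zle : Zbar_moment (r * 2) m.+1 <= B * q ^+ (r * 2).
    by rewrite -ler_pdivrMr ?exprn_gt0 // (le_trans (ler_norm _)).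
  have L1 : 1 <= l ^+ (s * 2) by rewrite exprn_ege1.
  have A0 : 0 <= B * q ^+ r by rewrite mulr_ge0 ?ltW.
  have A1 : (q ^+ r)^-1 * Zbar_moment (r * 2) m.+1 <= B * q ^+ r.
    by rewrite mulrC ler_pdivrMr // -mulrA -expr2 -exprM.
  have A2 := ler_wpM2l (ltW qr0) Q.
  have A3 : B * q ^+ r <= B * q ^+ r * l ^+ (s * 2) by rewrite ler_peMr.
  have A4 : 0 <= q ^+ r * (K * 3 ^+ (s * 2) * l ^+ (s * 2)).
    by apply: mulr_ge0 (ltW qr0) _; apply: mulr_ge0 => //; lra.
  apply: le_trans (normr_tree_mean_mul_le _ _ qr0) _.
  rewrite (eq_tree_mean (fun t => esym (exprM _ r 2))).
  rewrite (eq_tree_mean (fun t => esym (exprM (root_degree R (n := m.+2) t) s 2))).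
  rewrite -/(Zbar_moment _ _).
  have -> : (B + K * 3 ^+ (s * 2)) * (q ^+ r * l ^+ (s * 2)) =
    B * q ^+ r * l ^+ (s * 2) + q ^+ r * (K * 3 ^+ (s * 2) * l ^+ (s * 2)) by ring.
  lra.
near=> n.
have n2 : (2 <= n)%N by near: n; exact: nbhs_infty_ge.
have ne : expR 1 <= n%:R :> R by near: n; exact: nbhs_infty_ger.
have HBn : `|Zbar_moment (r * 2) n.-1 / sqrt_size R n.-1 ^+ (r * 2)| <= B.
  near: n.
  have [N _ HN] : \forall m \near \oo, `|Zbar_moment (r * 2) m / sqrt_size R m ^+ (r * 2)| <= B.
    by apply: cvgr_norm_le (@cvg_Zbar_moment (r * 2)) _ _; rewrite ltrDl.
  by exists N.+1 => // -[|n] //= Nn; apply: HN.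
move: n2 ne HBn; case: (n) => [|[|m]] // _ me HB.
have l1 : 1 <= ln m.+2%:R :> R by rewrite -[X in X <= _]expRK ler_ln ?posrE ?expR_gt0.
have l0 : 0 <= ln m.+2%:R :> R by apply: le_trans l1.
apply: le_trans (bound m l1 HB) _.
by rewrite powR_half normrM !normrX (ger0_norm l0) ger0_norm ?sqrtr_ge0.
Unshelve. all: end_near. Qed.

End Conclusion.

Theorem proposition3p4 (R : realType) (k : nat) (hk : (2 <= k)%N) :
  (forall r s : nat,
     Ohat (fun n => expect (fun t : rec_tree n =>
                      Zagreb_bar R k t ^+ r * root_degree R t ^+ s))
          (r%:R / 2)) /\
  (exists sigma : R, forall r : nat,
     expect (fun t : rec_tree n => Zagreb_bar R k t ^+ r)
       / n%:R `^ (r%:R / 2) @[n --> \oo]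
     --> gauss_moment R r * sigma ^+ r).
Proof.
split; first by move=> r s; exact: Ohat_Zagreb_bar.
by exists (Zbar_scale R k) => r; exact: cvg_Zagreb_bar.
Qed.
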